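(* Let $\chi=(x_0,\dots,x_N)$ with $a=x_0<x_1<\dots<x_N=b$ be a partition of $[a,b]$, let $\delta_{max}=\max_{0\le i\le N-1}(x_{i+1}-x_i)$, and let $\mathcal L\ge 0$ and $C$ be constants. Let $\phi:[a,b]\times\mathbb R_+\to\mathbb R_+$ be a continuous function, non-decreasing in its second argument, with $\phi(x,0)=0$ for all $x$. Let $A_\chi(f,x)=\sum_{i=0}^N c_i(x)f(x_i)$ be a linear operator, with $c_i:[a,b]\to\mathbb R$, such that for every $s\in\mathcal S_\chi\cap Lip([a,b],\mathcal L)$ and every $x\in[a,b]$ $$|A_\chi(s,x)-s(x)|\le C\,\mathcal L\,\phi(x,\delta_{max}).$$ Then for every set-valued function $F:[a,b]\to K(\mathbb R^n)$ with $F\in Lip([a,b],\mathcal L)$ and every $x\in[a,b]$, $$\mathrm{haus}\big(A^M_\chi(F,x),F(x)\big)\le 2\,\mathcal L\,\delta_{max}+C\,\mathcal L\,\phi(x,\delta_{max}).$$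
   Context: $\mathbb R_+=[0,\infty)$. $K(\mathbb R^n)$ is the collection of all nonempty compact subsets of $\mathbb R^n$, $|\cdot|$ is the Euclidean norm, $\mathrm{dist}(a,B)=\inf_{b\in B}|a-b|$, and $\mathrm{haus}(A,B)=\max\{\sup_{a\in A}\mathrm{dist}(a,B),\sup_{b\in B}\mathrm{dist}(b,A)\}$ is the Hausdorff distance. $\Pi_B(a)=\{b\in B:|a-b|=\mathrm{dist}(a,B)\}$ is the set of projections of $a$ on $B$. For a metric space $(X,\rho)$ (here $X=\mathbb R^n$ with the Euclidean distance, or $X=K(\mathbb R^n)$ with the Hausdorff distance), $Lip([a,b],\mathcal L)$ is the set of $f:[a,b]\to X$ with $\rho(f(x),f(y))\le\mathcal L|x-y|$ for all $x,y\in[a,b]$. $\mathcal S_\chi$ is the set of continuous piecewise linear functions $s:[a,b]\to\mathbb R^n$ with knots at $\chi$ (i.e. affine on each $[x_i,x_{i+1}]$). The operator $A_\chi$ is applied to $\mathbb R^n$-valued functions by the same formula. A metric chain of a finite sequence of compact sets $\{A_0,\dots,A_N\}$ is a vector $(a_0,\dots,a_N)$ with $a_i\in A_i$ for all $i$, for which there is $j$, $0\le j\le N$, such that $a_{i-1}\in\Pi_{A_{i-1}}(a_i)$ for $1\le i\le j$ and $a_{i+1}\in\Pi_{A_{i+1}}(a_i)$ for $j\le i\le N-1$. $CH(A_0,\dots,A_N)$ denotes the set of all metric chains. The metric linear combination with coefficients $\lambda_0,\dots,\lambda_N\in\mathbb R$ is $$\bigoplus_{i=0}^N\lambda_iA_i=\Big\{\sum_{i=0}^N\lambda_ia_i:(a_0,\dots,a_N)\in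 CH(A_0,\dots,A_N)\Big\}.$$ The metric analogue of $A_\chi$ is the operator on set-valued functions $A^M_\chi(F,x)=\bigoplus_{i=0}^N c_i(x)F(x_i)$. *)

(* Defs.v *)
From HB Require Import structures.
From mathcomp Require Import all_boot all_order all_algebra.
From mathcomp Require Import all_classical all_reals all_analysis.

Set Implicit Arguments.
Unset Strict Implicit.
Unset Printing Implicit Defensive.

Import Order.TTheory GRing.Theory Num.Theory.
Import numFieldNormedType.Exports.

Local Open Scope classical_set_scope.
Local Open Scope ring_scope.

(* The norm `|v| of the library on 'rV[R]_n is the max norm; the Euclidean
   norm induces the same topology, so [compact] and [continuous] below keep
   their usual meaning in R^n. *)
Definition eucl_norm (R : realType) (n : nat) (v : 'rV[R]_n) : R :=
  Num.sqrt (\sum_(k < n) v 0 k ^+ 2).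

Definition eucl_dist (R : realType) (n : nat) (u v : 'rV[R]_n) : R :=
  eucl_norm (u - v).

Definition eucl_dist_to (R : realType) (n : nat) (u : 'rV[R]_n) (B : set 'rV[R]_n) : R :=
  inf [set eucl_dist u v | v in B].

(* [inf] and [sup] are the real-valued operators, with junk value 0 on sets that
   are empty or unbounded on the relevant side. Hence [haus A B] is the
   Hausdorff distance when A and B are nonempty and bounded; this covers
   nonempty compact sets and their metric linear combinations. *)
Definition haus (R : realType) (n : nat) (A B : set 'rV[R]_n) : R :=
  Num.max (sup [set eucl_dist_to u B | u in A]) (sup [set eucl_dist_to v A | v in B]).

Definition projections (R : realType) (n : nat) (B : set 'rV[R]_n)
    (u : 'rV[R]_n) : set 'rV[R]_n :=
  [set v | B v /\ eucl_dist u v = eucl_dist_to u B].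

Definition nonempty_compacts (R : realType) (n : nat) : set (set 'rV[R]_n) :=
  [set A | A !=set0 /\ compact A].

(* Functions on [a, b] are represented by total functions on R of which only
   the values on [a, b] are ever constrained or used. *)
Definition Lip (R : realType) (X : Type) (rho : X -> X -> R) (a b L : R) :
    set (R -> X) :=
  [set f | forall t u : R, t \in `[a, b] -> u \in `[a, b] ->
     rho (f t) (f u) <= L * `|t - u|].

(* For i : 'I_N, the indices i and i + 1 seen in 'I_N.+1. *)
Definition idx (N : nat) (i : 'I_N) : 'I_N.+1 := widen_ord (leqnSn N) i.
Definition idxS (N : nat) (i : 'I_N) : 'I_N.+1 := lift ord0 i.

Definition is_partition (R : realType) (a b : R) (N : nat)
    (chi : 'I_N.+1 -> R) : Prop :=
  [/\ (0 < N)%N, chi ord0 = a, chi ord_max = b &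
      forall i : 'I_N, chi (idx i) < chi (idxS i)].

(* The default value 0 of the maximum is harmless: for a partition the range is
   nonempty and all the differences are positive. *)
Definition delta_max (R : realType) (N : nat) (chi : 'I_N.+1 -> R) : R :=
  \big[Num.max/0]_(i < N) (chi (idxS i) - chi (idx i)).

Definition piecewise_linear (R : realType) (n : nat) (a b : R) (N : nat)
    (chi : 'I_N.+1 -> R) : set (R -> 'rV[R]_n) :=
  [set s | {within `[a, b], continuous s} /\
     forall i : 'I_N, exists u v : 'rV[R]_n,
       forall t : R, t \in `[chi (idx i), chi (idxS i)] -> s t = u + t *: v].

Definition lin_op (R : realType) (n N : nat) (chi : 'I_N.+1 -> R)
    (c : 'I_N.+1 -> R -> R) (f : R -> 'rV[R]_n) (x : R) : 'rV[R]_n :=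
  \sum_(i < N.+1) c i x *: f (chi i).

Definition metric_chains (R : realType) (n N : nat)
    (A : 'I_N.+1 -> set 'rV[R]_n) : set ('I_N.+1 -> 'rV[R]_n) :=
  [set p | (forall i, A i (p i)) /\
     exists j : 'I_N.+1, forall i : 'I_N,
       ((i < j)%N -> projections (A (idx i)) (p (idxS i)) (p (idx i))) /\
       ((j <= i)%N -> projections (A (idxS i)) (p (idx i)) (p (idxS i)))].

Definition metric_lin_comb (R : realType) (n N : nat) (lam : 'I_N.+1 -> R)
    (A : 'I_N.+1 -> set 'rV[R]_n) : set 'rV[R]_n :=
  [set \sum_(i < N.+1) lam i *: p i | p in metric_chains A].

Definition metric_op (R : realType) (n N : nat) (chi : 'I_N.+1 -> R)
    (c : 'I_N.+1 -> R -> R) (F : R -> set 'rV[R]_n) (x : R) : set 'rV[R]_n :=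
  metric_lin_comb (fun i => c i x) (fun i => F (chi i)).

(* Main.v *)
Require Import Defs.
From mathcomp Require Import all_boot all_order all_algebra.
From mathcomp Require Import all_classical all_reals all_analysis.
From mathcomp Require Import ring lra.

Set Implicit Arguments.
Unset Strict Implicit.
Unset Printing Implicit Defensive.

Import Order.TTheory GRing.Theory Num.Theory.
Import numFieldNormedType.Exports.

Local Open Scope classical_set_scope.
Local Open Scope ring_scope.

(** Join the points of a metric chain of the values [F (chi i)] by segments over
    the knots. Of two consecutive points of a chain, one is a projection of the
    other, so they are at most [L * (chi (idxS i) - chi (idx i))] apart ([F] being
    [L]-Lipschitz for the Hausdorff distance), and the resulting polyline is a
    piecewise linear [L]-Lipschitz function ([interpolant_Lip]). The hypothesis
    on the linear operator applies to it, and since the operator only sees the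
    values at the knots ([interpolant_knot]), it bounds the distance between the
    point of the metric linear combination given by the chain and the value of
    the polyline at [x] by [C * L * phi x (delta_max chi)].

    It remains to compare polylines with [F x], through a knot [chi i0] at
    distance at most [delta_max chi] from [x]. Moving along a polyline from [x]
    to [chi i0] costs at most [L * delta_max chi], and projecting between
    [F (chi i0)] and [F x] costs as much again. For a point of the metric linear
    combination, one projects the value of its chain at [i0] to [F x]. For a
    point [v] of [F x], one projects [v] to [F (chi i0)] and completes this
    projection to a chain by projecting successively to the left and to the
    right ([metric_chain_through]). *)

(** * The Euclidean norm *)

Section EuclideanNorm.
Context {R : realType} {n : nat}.
Implicit Types u v w : 'rV[R]_n.

Lemma eucl_norm_ge0 v : 0 <= eucl_norm v.
Proof. exact: sqrtr_ge0. Qed.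

Lemma eucl_norm_sqr v : eucl_norm v ^+ 2 = \sum_(k < n) v 0 k ^+ 2.
Proof. by rewrite sqr_sqrtr// sumr_ge0// => k _; exact: sqr_ge0. Qed.

Lemma eucl_norm0_eq0 v : eucl_norm v = 0 -> v = 0.
Proof.
move=> v0; have := eucl_norm_sqr v; rewrite v0 expr0n/= => /esym/eqP.
rewrite psumr_eq0 => [/allP vk0|k _]; last exact: sqr_ge0.
apply/rowP => k; rewrite mxE; apply/eqP.
by have := vk0 k (mem_index_enum k); rewrite expf_eq0.
Qed.

Lemma eucl_norm0 : eucl_norm (0 : 'rV[R]_n) = 0.
Proof.
by rewrite /eucl_norm big1 ?sqrtr0// => k _; rewrite mxE expr0n.
Qed.

Lemma eucl_normZ (k : R) v : eucl_norm (k *: v) = `|k| * eucl_norm v.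
Proof.
rewrite /eucl_norm -sqrtr_sqr -sqrtrM ?sqr_ge0//; congr Num.sqrt.
by rewrite mulr_sumr; apply: eq_bigr => i _; rewrite mxE exprMn.
Qed.

(** With [a] and [b] the norms of [u] and [v], the squared norm of
    [b *: u - a *: v] is [2 * (a * b) * (a * b - s)], where [s] is the scalar
    product; dividing by [a * b] requires both norms to be nonzero. *)
Lemma Cauchy_Schwarz u v :
  \sum_(k < n) u 0 k * v 0 k <= eucl_norm u * eucl_norm v.
Proof.
have [u0|u_neq0] := eqVneq (eucl_norm u) 0.
  rewrite u0 mul0r big1// => k _.
  by rewrite (eucl_norm0_eq0 u0) mxE mul0r.
have [v0|v_neq0] := eqVneq (eucl_norm v) 0.
  rewrite v0 mulr0 big1// => k _.
  by rewrite (eucl_norm0_eq0 v0) mxE mulr0.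
have ab_gt0 : 0 < eucl_norm u * eucl_norm v.
  by rewrite mulr_gt0// lt_neqAle eq_sym ?u_neq0 ?v_neq0 eucl_norm_ge0.
have := eucl_norm_sqr u; have := eucl_norm_sqr v.
move: (eucl_norm u) (eucl_norm v) ab_gt0 => a b ab_gt0 Eb Ea.
have : 0 <= \sum_(k < n) (b * u 0 k - a * v 0 k) ^+ 2.
  by apply: sumr_ge0 => k _; exact: sqr_ge0.
have -> : \sum_(k < n) (b * u 0 k - a * v 0 k) ^+ 2 =
    b ^+ 2 * \sum_(k < n) u 0 k ^+ 2 + a ^+ 2 * \sum_(k < n) v 0 k ^+ 2
    - 2 * (a * b) * \sum_(k < n) u 0 k * v 0 k.
  rewrite !mulr_sumr -big_split/= -sumrB; apply: eq_bigr => k _; ring.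
rewrite -Ea -Eb; set s := \sum_(k < n) _ => h.
suff : 0 <= 2 * (a * b) * (a * b - s).
  by rewrite pmulr_rge0 ?subr_ge0// mulr_gt0.
by move: h; congr (0 <= _); ring.
Qed.

Lemma eucl_normD u v : eucl_norm (u + v) <= eucl_norm u + eucl_norm v.
Proof.
rewrite -ler_sqr ?nnegrE ?addr_ge0 ?eucl_norm_ge0// sqrrD !eucl_norm_sqr.
under eq_bigr do rewrite mxE sqrrD.
by rewrite !big_split/= lerD2r lerD2l mulr2n lerD// Cauchy_Schwarz.
Qed.

Lemma eucl_norm_sum (I : Type) (r : seq I) (f : I -> 'rV[R]_n) :
  eucl_norm (\sum_(i <- r) f i) <= \sum_(i <- r) eucl_norm (f i).
Proof.
elim/big_rec2: _ => [|i y x _ le_xy]; first by rewrite eucl_norm0.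
by rewrite (le_trans (eucl_normD _ _))// lerD2l.
Qed.

Lemma eucl_dist_ge0 u v : 0 <= eucl_dist u v.
Proof. exact: eucl_norm_ge0. Qed.

Lemma eucl_distC u v : eucl_dist u v = eucl_dist v u.
Proof.
by rewrite /eucl_dist -opprB -scaleN1r eucl_normZ normrN1 mul1r.
Qed.

Lemma eucl_dist_triangle v u w :
  eucl_dist u w <= eucl_dist u v + eucl_dist v w.
Proof. by rewrite /eucl_dist -(subrKA v) eucl_normD. Qed.

Lemma eucl_norm_continuous : continuous (@eucl_norm R n).
Proof.
move=> v; apply: continuous_comp; last exact: sqrt_continuous.
apply: continuous_big; first exact: add_continuous.
move=> k _ w.
apply: (@continuous_comp _ _ _ (fun w : 'rV[R]_n => w 0 k) (fun t : R => t ^+ 2)).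
  exact: coord_continuous.
exact: exprn_continuous.
Qed.

Lemma eucl_dist_continuous u : continuous (eucl_dist u).
Proof.
move=> v.
apply: (@continuous_comp _ _ _ (fun w : 'rV[R]_n => u - w) (@eucl_norm R n)).
  by apply: continuousB; [exact: cst_continuous|exact: cvg_id].
exact: eucl_norm_continuous.
Qed.

End EuclideanNorm.

(** * Projections and the Hausdorff distance *)

Section Projections.
Context {R : realType} {n : nat}.
Implicit Types (u v w : 'rV[R]_n) (A B : set 'rV[R]_n).

Lemma eucl_dist_to_le u v B : B v -> eucl_dist_to u B <= eucl_dist u v.
Proof.
move=> Bv; apply: ge_inf; last by exists v.
by exists 0 => _ [w _ <-]; exact: eucl_dist_ge0.
Qed.

Lemma projections_neq0 B u : nonempty_compacts B -> projections B u !=set0.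
Proof.
move=> [B0 cB].
have [|v vB vmin] := compact_EVT_min B0 cB (f := eucl_dist u).
  by apply: continuous_subspaceT => w; exact: eucl_dist_continuous.
rewrite inE in vB; exists v; split=> //; apply/eqP.
rewrite eq_le eucl_dist_to_le// andbT; apply: lb_le_inf.
  by exists (eucl_dist u v); exists v.
by move=> _ [w Bw <-]; apply: vmin; rewrite inE.
Qed.

Lemma hausC A B : haus A B = haus B A.
Proof. by rewrite /haus maxC. Qed.

(** Compactness of [A] makes the distances to [B] bounded above; otherwise the
    supremum in [haus] would take its default value. *)
Lemma eucl_dist_to_le_haus A B u :
  nonempty_compacts A -> nonempty_compacts B -> A u ->
  eucl_dist_to u B <= haus A B.
Proof.
move=> [A0 cA] [[v Bv] _] Au; rewrite /haus le_max; apply/orP; left.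
apply: ub_le_sup; last by exists u.
have [|w wA wmax] := compact_EVT_max A0 cA (f := eucl_dist v).
  by apply: continuous_subspaceT => z; exact: eucl_dist_continuous.
exists (eucl_dist v w) => _ [z Az <-].
rewrite (le_trans (eucl_dist_to_le z Bv))// eucl_distC.
by apply: wmax; rewrite inE.
Qed.

(** The condition [0 <= M] covers the empty sets, on which the suprema are 0. *)
Lemma haus_le A B M : 0 <= M ->
  (forall u, A u -> exists2 v, B v & eucl_dist u v <= M) ->
  (forall v, B v -> exists2 u, A u & eucl_dist v u <= M) ->
  haus A B <= M.
Proof.
move=> M0 AB BA; rewrite /haus ge_max.
have half D E : (forall u, D u -> exists2 v, E v & eucl_dist u v <= M) ->
    sup [set eucl_dist_to u E | u in D] <= M.
  move=> DE; have [->|/set0P D0] := eqVneq D set0.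
    by rewrite image_set0 sup0.
  apply: ge_sup; first by case: D0 => d Dd; exists (eucl_dist_to d E); exists d.
  move=> _ [u Du <-]; have [v Ev] := DE u Du.
  exact/le_trans/eucl_dist_to_le.
by rewrite !half.
Qed.

Lemma projections_Lip (F : R -> set 'rV[R]_n) (a b L t t' : R) u v :
  (forall t, t \in `[a, b] -> nonempty_compacts (F t)) ->
  Lip (@haus R n) a b L F -> t \in `[a, b] -> t' \in `[a, b] ->
  F t u -> projections (F t') u v -> eucl_dist u v <= L * `|t - t'|.
Proof.
move=> Fc FL tab t'ab Fu [_ ->].
apply: le_trans (FL _ _ tab t'ab).
by apply: eucl_dist_to_le_haus => //; exact: Fc.
Qed.

End Projections.

(** * Partitions *)

Section Ordinals.
Context {N : nat}.

Lemma inord_idx (i : 'I_N) : inord i = idx i.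
Proof. by apply: val_inj; rewrite /= inordK// ltnS ltnW. Qed.

Lemma inord_idxS (i : 'I_N) : inord i.+1 = idxS i.
Proof. by apply: val_inj; rewrite /= inordK// ltnS. Qed.

Lemma telescope_idx (V : zmodType) (f : 'I_N.+1 -> V) :
  \sum_(i < N) (f (idxS i) - f (idx i)) = f ord_max - f ord0.
Proof.
transitivity (\sum_(0 <= k < N) (f (inord k.+1) - f (inord k))).
  by rewrite big_mkord; apply: eq_bigr => i _; rewrite inord_idx inord_idxS.
rewrite telescope_sumr//; congr (f _ - f _); apply: val_inj => /=; exact: inordK.
Qed.

End Ordinals.

Section Partition.
Context {R : realType} {a b : R} {N : nat} {chi : 'I_N.+1 -> R}.
Context (chiP : is_partition a b chi).

Lemma partition_homo (i j : 'I_N.+1) : (i <= j)%N -> chi i <= chi j.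
Proof.
have [_ _ _ lt_chi] := chiP.
(* beyond N the sequence is continued by the constant chi ord_max *)
have homo : {homo (fun k => chi (inord (minn k N))) :
    k l / (k <= l)%N >-> k <= l}.
  apply: Order.NatMonotonyTheory.nondecnP => k; have [kN|Nk] := ltnP k N.
    rewrite (minn_idPl kN).
    by have := lt_chi (Ordinal kN); rewrite -inord_idx -inord_idxS => /ltW.
  by rewrite (minn_idPr (leqW Nk)).
by move=> /homo; rewrite !(minn_idPl _) ?inord_val// -ltnS.
Qed.

Lemma partition_in (i : 'I_N.+1) : chi i \in `[a, b].
Proof.
have [_ <- <- _] := chiP; rewrite in_itv/= !partition_homo//.
by rewrite -ltnS.
Qed.

Lemma partition_step (i : 'I_N) : chi (idxS i) - chi (idx i) <= delta_max chi.
Proof. exact: le_bigmax. Qed.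

Lemma delta_max_ge0 : 0 <= delta_max chi.
Proof. exact: bigmax_ge_id. Qed.

(** The last knot on the left of [x] will do: unless it is [b], the next one
    lies on the right of [x]. *)
Lemma partition_near (x : R) : x \in `[a, b] ->
  exists i : 'I_N.+1, `|x - chi i| <= delta_max chi.
Proof.
have [_ chi0 chiN _] := chiP; rewrite in_itv/= => /andP[ax xb].
pose P (i : 'I_N.+1) := chi i <= x.
have P0 : P ord0 by rewrite /P chi0.
case: (@arg_maxnP _ ord0 P (fun i => i : nat) P0) => i Pi imax.
exists i; rewrite ger0_norm ?subr_ge0//.
have [iN|Ni] := ltnP i N; last first.
  have -> : i = ord_max.
    by apply: val_inj; apply/eqP; rewrite eqn_leq -ltnS ltn_ord.
  by rewrite chiN (le_trans _ delta_max_ge0)// subr_le0.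
have idxi : idx (Ordinal iN) = i by exact: val_inj.
apply: le_trans (partition_step (Ordinal iN)).
rewrite idxi lerB// leNgt; apply/negP => /ltW /imax /=.
by rewrite /bump leq0n add1n ltnn.
Qed.

End Partition.

(** * Metric chains *)

Section Chains.
Context {R : realType} {n N : nat}.

(** Starting from [u] at the index [j], project successively onto the sets of
    higher index and onto the sets of lower index. *)
Lemma metric_chain_through (A : 'I_N.+1 -> set 'rV[R]_n) (j : 'I_N.+1) u :
  (forall i, nonempty_compacts (A i)) -> A j u ->
  exists2 p, metric_chains A p & p j = u.
Proof.
move=> Ac Au.
have /choice[pr prP] (iv : 'I_N.+1 * 'rV[R]_n) :
    exists w, projections (A iv.1) iv.2 w.
  exact: projections_neq0.
(* the points of the chain l steps to the right, resp. to the left, of j *)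
pose fwd := fix f k := if k is l.+1 then pr (inord (j + l.+1), f l) else u.
pose bwd := fix f k := if k is l.+1 then pr (inord (j - l.+1), f l) else u.
pose p (i : 'I_N.+1) := if (j <= i)%N then fwd (i - j)%N else bwd (j - i)%N.
have fwdP l : A (inord (j + l)) (fwd l).
  case: l => [|l] /=; first by rewrite addn0 inord_val.
  by have [] := prP (inord (j + l.+1), fwd l).
have bwdP l : A (inord (j - l)) (bwd l).
  case: l => [|l] /=; first by rewrite subn0 inord_val.
  by have [] := prP (inord (j - l.+1), bwd l).
exists p; last by rewrite /p leqnn subnn.
split=> [i|].
  rewrite /p; case: leqP => [ji|ij].
    by have := fwdP (i - j)%N; rewrite subnKC// inord_val.
  by have := bwdP (j - i)%N; rewrite subKn ?inord_val// ltnW.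
exists j => i; rewrite /p /=; split=> [ij|ji].
- rewrite [(j <= i)%N]leqNgt ij/= /bump leq0n add1n.
  have -> : (j - i = (j - i.+1).+1)%N by rewrite subnSK.
  have -> : (if (j <= i.+1)%N then fwd (i.+1 - j)%N else bwd (j - i.+1)%N) =
      bwd (j - i.+1)%N.
    case: leqP => // ji.
    by have -> : (j : nat) = i.+1; [apply/eqP; rewrite eqn_leq ij ji|rewrite subnn].
  rewrite /= -[idx i]inord_idx.
  have {1}-> : nat_of_ord i = (j - (j - i.+1).+1)%N by rewrite subnSK// subKn// ltnW.
  exact: prP (_, _).
- rewrite ji /bump leq0n add1n leqW// subSn//= -inord_idxS.
  have {1}-> : i.+1 = (j + (i - j).+1)%N by rewrite addnS subnKC.
  exact: prP (_, _).
Qed.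

(** One of two consecutive points of a chain is a projection of the other, so
    their distance is at most the Hausdorff distance of the two sets. *)
Lemma metric_chain_Lip (F : R -> set 'rV[R]_n) (a b L : R) (chi : 'I_N.+1 -> R) p :
  is_partition a b chi ->
  (forall t, t \in `[a, b] -> nonempty_compacts (F t)) ->
  Lip (@haus R n) a b L F -> metric_chains (fun i => F (chi i)) p ->
  forall i : 'I_N,
    eucl_dist (p (idxS i)) (p (idx i)) <= L * (chi (idxS i) - chi (idx i)).
Proof.
move=> chiP Fc FL [Fp [j pj]] i; have [_ _ _ lt_chi] := chiP.
have -> : chi (idxS i) - chi (idx i) = `|chi (idxS i) - chi (idx i)|.
  by rewrite ger0_norm// subr_ge0 ltW.
have [bwd fwd] := pj i; have [/bwd pr|/fwd pr] := ltnP i j.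
  by apply: (projections_Lip Fc FL _ _ _ pr); rewrite ?(partition_in chiP).
rewrite eucl_distC distrC.
by apply: (projections_Lip Fc FL _ _ _ pr); rewrite ?(partition_in chiP).
Qed.

End Chains.

(** * The polyline through the points of a chain *)

Section Interpolation.
Context {R : realType} {n N : nat}.

(** The polyline equal to [p i] at each [chi i]. The coefficient of the [i]-th
    slope is the length of the part of the [i]-th interval on the left of [t];
    unlike a definition by cases on the interval containing [t], this makes
    continuity immediate and turns the Lipschitz bound into a telescoping sum. *)
Definition interpolant (chi : 'I_N.+1 -> R) (p : 'I_N.+1 -> 'rV[R]_n) (t : R) :
    'rV[R]_n :=
  p ord0 + \sum_(i < N) (Num.min t (chi (idxS i)) - Num.min t (chi (idx i))) *:
    ((chi (idxS i) - chi (idx i))^-1 *: (p (idxS i) - p (idx i))).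

Context {a b : R} {chi : 'I_N.+1 -> R}.
Context (chiP : is_partition a b chi).
Implicit Type p : 'I_N.+1 -> 'rV[R]_n.

Lemma interpolant_knot p k : interpolant chi p (chi k) = p k.
Proof.
have [_ _ _ lt_chi] := chiP.
(* the summands at chi k telescope along p stopped at the index k *)
pose q (i : 'I_N.+1) := if (i <= k)%N then p i else p k.
rewrite /interpolant (eq_bigr (fun i => q (idxS i) - q (idx i))) => [|i _].
  rewrite telescope_idx /q leq0n subrKC; case: ifP => // Nk.
  by congr p; apply: val_inj; apply/eqP; rewrite eqn_leq Nk -ltnS ltn_ord.
have q_idxS : q (idxS i) = if (i < k)%N then p (idxS i) else p k by [].
have q_idx : q (idx i) = if (i <= k)%N then p (idx i) else p k by [].
rewrite q_idxS q_idx; case: ltnP => [ik|ki].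
  rewrite (ltnW ik) !min_r ?(partition_homo chiP) //=; last exact: ltnW.
  by rewrite scalerA divff ?scale1r// subr_eq0 gt_eqF.
rewrite !min_l ?(partition_homo chiP) ?subrr ?scale0r//=; last exact: leqW.
case: (leqP i k) => ik; last by rewrite subrr.
have -> : k = idx i by apply: val_inj; apply/eqP; rewrite eqn_leq ik ki.
by rewrite subrr.
Qed.

Lemma interpolant_continuous p : continuous (interpolant chi p).
Proof.
move=> t; apply: continuousD; first exact: cst_continuous.
apply: continuous_big; first exact: add_continuous.
move=> i _ {}t; apply: cvgZr_tmp.
have cmin c : {for t, continuous (fun t : R => Num.min t c)}.
  by apply: continuous_min; [exact: cvg_id|exact: cst_continuous].
by apply: cvgB; exact: cmin.
Qed.

Lemma interpolant_piecewise_linear p :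
  piecewise_linear a b chi (interpolant chi p).
Proof.
split; first exact/continuous_subspaceT/interpolant_continuous.
move=> k.
pose d (i : 'I_N) := (chi (idxS i) - chi (idx i))^-1 *: (p (idxS i) - p (idx i)).
(* on the k-th interval, Num.min t (chi i) is the affine map al i + t * be i *)
pose al (i : 'I_N.+1) := if (i <= k)%N then chi i else 0.
pose be (i : 'I_N.+1) : R := if (i <= k)%N then 0 else 1.
exists (p ord0 + \sum_(i < N) (al (idxS i) - al (idx i)) *: d i),
  (\sum_(i < N) (be (idxS i) - be (idx i)) *: d i) => t.
rewrite in_itv/= => /andP[kt tk].
have mint i : Num.min t (chi i) = al i + t * be i.
  rewrite /al /be; case: leqP => ik; rewrite ?mulr0 ?addr0 ?mulr1 ?add0r.
    by apply/min_r/(le_trans _ kt)/(partition_homo chiP).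
  by apply/min_l/(le_trans tk)/(partition_homo chiP).
rewrite /interpolant -addrA scaler_sumr -big_split/=; congr (_ + _).
apply: eq_bigr => i _; rewrite [t *: _]scalerA -scalerDl !mint.
by congr (_ *: _); ring.
Qed.

(** Between [t] and [u], with [t <= u], the length covered in the [i]-th interval
    is nonnegative and contributes at most [L] times itself; these lengths add up
    to [u - t] when [t] and [u] lie in [[a, b]]. *)
Lemma interpolant_Lip p L : 0 <= L ->
  (forall i : 'I_N,
    eucl_dist (p (idxS i)) (p (idx i)) <= L * (chi (idxS i) - chi (idx i))) ->
  Lip (@eucl_dist R n) a b L (interpolant chi p).
Proof.
move=> L0 pL; have [_ chi0 chiN lt_chi] := chiP.
have incr t u : t \in `[a, b] -> u \in `[a, b] -> t <= u ->
    eucl_dist (interpolant chi p u) (interpolant chi p t) <= L * (u - t).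
  rewrite !in_itv/= => /andP[at_ tb] /andP[au ub] tu.
  (* the length of [t, u] on the left of chi i *)
  pose m i := Num.min u (chi i) - Num.min t (chi i).
  have -> : u - t = \sum_(i < N) (m (idxS i) - m (idx i)).
    rewrite telescope_idx /m chi0 chiN (min_l ub) (min_l tb).
    by rewrite (min_r au) (min_r at_) subrr subr0.
  rewrite /eucl_dist /interpolant opprD addrACA subrr add0r -sumrB mulr_sumr.
  apply: le_trans (eucl_norm_sum _ _) _; apply: ler_sum => i _.
  rewrite -scalerBl scalerA eucl_normZ.
  set h := chi (idxS i) - chi (idx i); have h0 : 0 < h by rewrite subr_gt0.
  have m0 : 0 <= m (idxS i) - m (idx i).
    rewrite /m; have := lt_chi i; rewrite !minEle.
    by do ![case: ifPn => //; rewrite -?ltNge]; lra.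
  have -> : Num.min u (chi (idxS i)) - Num.min u (chi (idx i)) -
    (Num.min t (chi (idxS i)) - Num.min t (chi (idx i))) =
    m (idxS i) - m (idx i) by rewrite /m; ring.
  rewrite ger0_norm ?divr_ge0 ?(ltW h0)// -mulrA mulrC ler_wpM2r//.
  by rewrite mulrC ler_pdivrMr//; exact: pL.
move=> t u tab uab; have [tu|/ltW ut] := leP t u.
  by rewrite eucl_distC distrC ger0_norm ?subr_ge0//; exact: incr.
by rewrite ger0_norm ?subr_ge0//; exact: incr.
Qed.

End Interpolation.

(** * The approximation theorem *)

Theorem theorem5p2 (R : realType) (n : nat) (a b : R) (N : nat)
  (chi : 'I_N.+1 -> R) (L C : R) (phi : R -> R -> R) (c : 'I_N.+1 -> R -> R)
  (chiP : is_partition a b chi)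
  (L_ge0 : 0 <= L)
  (phi_ge0 : forall t d : R, t \in `[a, b] -> 0 <= d -> 0 <= phi t d)
  (phi_cont : {within [set p : R * R | p.1 \in `[a, b] /\ 0 <= p.2],
     continuous (fun p : R * R => phi p.1 p.2)})
  (phi_mono : forall t d d' : R, t \in `[a, b] -> 0 <= d -> d <= d' ->
     phi t d <= phi t d')
  (phi0 : forall t : R, t \in `[a, b] -> phi t 0 = 0)
  (approx : forall s : R -> 'rV[R]_n,
     piecewise_linear a b chi s -> Lip (@eucl_dist R n) a b L s ->
     forall x : R, x \in `[a, b] ->
       eucl_norm (lin_op chi c s x - s x) <= C * L * phi x (delta_max chi)) :
  forall F : R -> set 'rV[R]_n,
    (forall t : R, t \in `[a, b] -> nonempty_compacts (F t)) ->
    Lip (@haus R n) a b L F ->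
    forall x : R, x \in `[a, b] ->
      haus (metric_op chi c F x) (F x) <=
        2 * L * delta_max chi + C * L * phi x (delta_max chi).
Proof.
move=> F Fc FL x xab.
have [i0 xi0] := partition_near chiP xab.
have i0ab := partition_in chiP i0.
set D := delta_max chi in xi0 *; have D0 : 0 <= D := delta_max_ge0.
have Ldist : L * `|x - chi i0| <= L * D by exact: ler_wpM2l.
have chainP p : metric_chains (fun i => F (chi i)) p ->
    eucl_dist (\sum_(i < N.+1) c i x *: p i) (interpolant chi p x)
      <= C * L * phi x D /\
    eucl_dist (p i0) (interpolant chi p x) <= L * D.
  move=> chp; have pL := metric_chain_Lip chiP Fc FL chp.
  have sL := interpolant_Lip chiP L_ge0 pL; split.
    have := approx _ (interpolant_piecewise_linear chiP p) sL x xab.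
    by rewrite /lin_op; under eq_bigr do rewrite (interpolant_knot chiP).
  rewrite -{1}(interpolant_knot chiP p i0) (le_trans (sL _ _ i0ab xab))//.
  by rewrite distrC.
have Fchi i : nonempty_compacts (F (chi i)) by exact/Fc/partition_in.
apply: haus_le.
(* the error bound of the operator is nonnegative since some chain exists *)
- have [v Fv] := (Fchi i0).1.
  have [p /chainP[+ _] _] := metric_chain_through Fchi Fv.
  move=> /(le_trans (eucl_dist_ge0 _ _)) ?.
  by rewrite addr_ge0// -mulrA mulr_ge0// mulr_ge0.
- move=> _ [p chp <-]; have [qs ps] := chainP _ chp.
  have [v vP] := projections_neq0 (p i0) (Fc _ xab).
  exists v; first exact: vP.1.
  have pv := projections_Lip Fc FL i0ab xab (chp.1 i0) vP; rewrite distrC in pv.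
  have := eucl_dist_triangle (interpolant chi p x)
    (\sum_(i < N.+1) c i x *: p i) v.
  have := eucl_dist_triangle (p i0) (interpolant chi p x) v.
  rewrite (eucl_distC (interpolant chi p x) (p i0)); lra.
- move=> v Fv; have [u uP] := projections_neq0 v (Fchi i0).
  have [p chp pu] := metric_chain_through Fchi uP.1.
  have [qs ps] := chainP _ chp.
  exists (\sum_(i < N.+1) c i x *: p i); first by exists p.
  have vu := projections_Lip Fc FL xab i0ab Fv uP.
  have := eucl_dist_triangle (interpolant chi p x)
    v (\sum_(i < N.+1) c i x *: p i).
  have := eucl_dist_triangle u v (interpolant chi p x).
  rewrite -{2}pu (eucl_distC (interpolant chi p x)); lra.
Qed.
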